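(* Let $G$ be a compact-bounded paratopological group such that for every compact subset $K\subset G$ the set $K^{-1}=\{x^{-1}:x\in K\}$ is countably compact in $G$. Then $G$ is 2-pseudocompact.
   Context: All topological spaces (in particular all paratopological groups) are assumed to be Hausdorff. A paratopological group is a group with a topology for which multiplication is jointly continuous. A space $X$ is compact-bounded if for every countable family $\mathcal U$ of non-empty open subsets of $X$ there is a compact $K\subset X$ which meets each element of $\mathcal U$. ''$K^{-1}$ is countably compact in $G$'' means that $K^{-1}$, with the subspace topology from $G$, is countably compact. A paratopological group $G$ is 2-pseudocompact if for every decreasing sequence $\{U_n:n\in\omega\}$ of non-empty open subsets of $G$ one has $\bigcap_{n\in\omega}\overline{U_n^{-1}}\neq\emptyset$, closures being taken in $G$. *)

(* Defs.v *)
From HB Require Import structures.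
From mathcomp Require Import all_boot.
From mathcomp Require Import all_classical topology.

Set Implicit Arguments.
Unset Strict Implicit.
Unset Printing Implicit Defensive.

Local Open Scope classical_set_scope.

HB.structure Definition PreTopologicalGroup :=
  {G of Topological G & Group G}.

HB.mixin Record PreTopologicalGroup_isParatopologicalGroup G
    & PreTopologicalGroup G := {
  mulg_continuous : continuous (fun x : G * G => (x.1 * x.2)%g)
}.

(* The Hausdorff axiom is not part of the structure: it is a separate
   hypothesis, expressed by [hausdorff_space]. *)
#[short(type="paratopologicalGroupType")]
HB.structure Definition ParatopologicalGroup :=
  {G of PreTopologicalGroup_isParatopologicalGroup G & PreTopologicalGroup G}.

Definition set_inv (G : groupType) (A : set G) : set G := [set x^-1%g | x in A].

(* [open_fam_of A D f] says that the [f i] are open in the subspace [A]; this is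
   [cover_compact] restricted to countable covers. *)
Definition countably_compact (T : topologicalType) (A : set T) :=
  forall (I : choiceType) (D : set I) (f : I -> set T), countable D ->
    open_fam_of A D f ->
    A `<=` \bigcup_(i in D) f i -> finite_subset_cover D f A.

Definition compact_bounded (T : topologicalType) :=
  forall F : set (set T), countable F ->
    (forall U, F U -> open U /\ U !=set0) ->
    exists2 K : set T, compact K & forall U, F U -> K `&` U !=set0.

Definition two_pseudocompact (G : paratopologicalGroupType) :=
  forall U : nat -> set G,
    (forall n, open (U n)) -> (forall n, U n !=set0) ->
    (forall n, U n.+1 `<=` U n) ->
    \bigcap_n closure (set_inv (U n)) !=set0.

(* Main.v *)
Require Import Defs.
From mathcomp Require Import all_boot.
From mathcomp Require Import finmap all_classical topology.

Local Open Scope classical_set_scope.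

(** Compact-boundedness yields a compact [K] meeting every [U n], so the closures of the
    [set_inv (U n)] all meet [set_inv K]. They decrease, so countable compactness of [set_inv K]
    forces a common point: otherwise finitely many of their complements would cover [set_inv K]. *)

Theorem proposition3p3 (G : paratopologicalGroupType)
    (hausdorffG : hausdorff_space G)
    (boundedG : compact_bounded G)
    (compactV : forall K : set G, compact K -> countably_compact (set_inv K)) :
  two_pseudocompact G.
Proof.
move=> U openU U0 decU.
have leU m n : m <= n -> U n `<=` U m.
  elim: n => [|n IHn]; first by rewrite leqn0 => /eqP ->.
  rewrite leq_eqVlt => /orP[/eqP -> //|]; rewrite ltnS => /IHn.
  exact: subset_trans.
have [|V [n _ <-]|K compactK KU] := boundedG (range U) => //.
  exact: card_image_le.
apply: contrapT => noCluster.
(* [open_fam_of] asks for traces on [set_inv K] of open sets, hence the intersection. *)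
pose f n := set_inv K `&` ~` closure (set_inv (U n)).
have [|x Kx|D _ coverD] := compactV K compactK nat setT f (countableP _).
- exists (fun n => ~` closure (set_inv (U n))) => // n _.
  by apply: closed_openC; exact: closed_closure.
- apply: contrapT => noN; apply: noCluster; exists x => n _.
  by apply: contrapT => nclx; apply: noN; exists n.
(* As [U] decreases, a point of [U N] lies in [U i] for all [i] in [D], so its inverse escapes every
   [f i] of the subcover. *)
pose N := \max_(i <- enum_fset D) i.
have [x [Kx UNx]] : K `&` U N !=set0 by apply: KU; exists N.
have [i /= iD [_]] := coverD x^-1%g (ex_intro2 _ _ x Kx erefl).
apply; apply: subset_closure; exists x => //.
by apply: (leU i N) UNx; exact: leq_bigmax_seq.
Qed.
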